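(* For every uncountable cardinal $\kappa$ there is a graph $G$ with $|V(G)|=\kappa$ which is not a proper minor of itself.
   Context: A graph $H$ is a minor of $G$ if there is a family $\{V_h:h\in V(H)\}$ of pairwise disjoint nonempty subsets of $V(G)$, each inducing a connected subgraph, such that there is a $V_h$–$V_{h'}$ edge in $G$ whenever $hh'\in E(H)$. $H$ is a proper minor of $G$ if $H$ is a minor of some proper subgraph of $G$. *)

(* Defs.v *)
From Stdlib Require Import Relation_Operators.
From mathcomp Require Import all_boot.
From mathcomp Require Import boolp classical_sets functions cardinality.

Set Implicit Arguments.
Unset Strict Implicit.
Unset Printing Implicit Defensive.

Local Open Scope classical_set_scope.

(* Simple undirected graphs, possibly infinite. The vertices form a subset of an
   ambient type, so that a subgraph is again a graph over the same type. *)
Record graph (T : Type) : Type := Graph {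
  vertices : set T;
  adj : T -> T -> Prop;
  adj_vertices : forall x y, adj x y -> vertices x /\ vertices y;
  adj_sym : forall x y, adj x y -> adj y x;
  adj_irrefl : forall x, ~ adj x x
}.

Definition subgraph (T : Type) (H G : graph T) : Prop :=
  vertices H `<=` vertices G /\ (forall x y, adj H x y -> adj G x y).

Definition proper_subgraph (T : Type) (H G : graph T) : Prop :=
  subgraph H G /\ ~ subgraph G H.

Section Induced.
Variables (T : Type) (G : graph T) (A : set T).

Let iadj (x y : T) : Prop := [/\ A x, A y & adj G x y].

Fact induced_adj_vertices x y :
  iadj x y -> (vertices G `&` A) x /\ (vertices G `&` A) y.
Proof. by case=> Ax Ay /(@adj_vertices _ G)[Gx Gy]. Qed.

Fact induced_adj_sym x y : iadj x y -> iadj y x.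
Proof. by case=> Ax Ay /(@adj_sym _ G). Qed.

Fact induced_adj_irrefl x : ~ iadj x x.
Proof. by case=> _ _ /(@adj_irrefl _ G). Qed.

Definition induced : graph T :=
  Graph induced_adj_vertices induced_adj_sym induced_adj_irrefl.

End Induced.

(* The graph without vertices counts as connected here; [minor] asks for
   nonempty branch sets separately. *)
Definition connected (T : Type) (G : graph T) : Prop :=
  forall x y, vertices G x -> vertices G y -> clos_refl_trans T (adj G) x y.

(* [B h] is the branch set of [h]; its value is irrelevant when [h] is not a
   vertex of [H]. *)
Definition minor (U T : Type) (H : graph U) (G : graph T) : Prop :=
  exists B : U -> set T,
    [/\ forall h, vertices H h ->
          [/\ B h `<=` vertices G, B h !=set0 & connected (induced G (B h))],
        trivIset (vertices H) B
      & forall h h', adj H h h' -> exists x y, [/\ B h x, B h' y & adj G x y]].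

Definition proper_minor (U T : Type) (H : graph U) (G : graph T) : Prop :=
  exists G' : graph T, proper_subgraph G' G /\ minor H G'.

(* Main.v *)
Require Import Defs.
From Stdlib Require Import Relation_Operators Wellfounded.
From mathcomp Require Import all_boot.
From mathcomp Require Import boolp classical_sets functions cardinality wochoice.

(* The graph is rigid in the strong sense that the only minor model of it in
   itself is the trivial one. It is built by induction on the cardinal [Z].

   Take a regular uncountable well-order [X], of size at most [Z], and the tree
   of finite sequences over [X]. For suitable ordinals [d] in [X] of cofinality
   omega add a vertex, its peak, joined to all nodes of a branch cofinal in [d], so
   that, for every node [s], the ordinals whose branch passes through [s] form
   a stationary set. Adjacent vertices are comparable in the tree order, so every
   branch set that meets the tree has a least node. Let [phi s] be the least
   node of the branch set of [s]. For [d] closed under a function depending on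
   the model, the peak at [d] can only be mapped to itself, and [phi] maps its
   branch into itself. Two such branches splitting right above [s] show that
   [phi s] is below [s]; as [phi] is injective, it is the identity, and then all
   peaks are fixed.

   If [Z] has size omega_1, take [X] to be [Z]. Otherwise, attach to each node a rigid graph of
   cardinality less than [Z], with the sizes cofinal in [Z]; once the tree
   is fixed, each of these is mapped into itself. Here [X] is omega_1 if [Z] has
   cofinality omega, and the cofinality of [Z] otherwise. *)

Set Implicit Arguments.
Unset Strict Implicit.
Unset Printing Implicit Defensive.

Local Open Scope classical_set_scope.
Local Open Scope card_scope.

(** * Regular well-orders *)

Record strict_wo (X : Type) (lt : X -> X -> Prop) : Prop := StrictWo {
  wo_wf : well_founded lt;
  wo_trans : forall x y z, lt x y -> lt y z -> lt x z;
  wo_total : forall x y, [\/ lt x y, x = y | lt y x]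
}.

(** Regularity together with uncountable cofinality. By constant sequences, the second clause also
    excludes a last element. *)
Definition regular (X : Type) (lt : X -> X -> Prop) : Prop :=
  (forall b (f : X -> X), exists c, forall x, lt x b -> lt (f x) c) /\
  (forall f : nat -> X, exists c, forall n, lt (f n) c).

Section WellOrder.
Variables (X : Type) (lt : X -> X -> Prop) (lt_wo : strict_wo lt).

Lemma wo_irr x : ~ lt x x.
Proof.
by elim/(well_founded_ind (wo_wf lt_wo)): x => x IH xx; exact: (IH x xx xx).
Qed.

Lemma wo_nltgt x y : lt x y -> ~ lt y x.
Proof. by move=> xy yx; apply: (@wo_irr x); apply: (wo_trans lt_wo) yx. Qed.

Lemma wo_least (P : X -> Prop) x :
  P x -> exists2 m, P m & forall y, P y -> ~ lt y m.
Proof.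
elim/(well_founded_ind (wo_wf lt_wo)): x => x IH Px.
case: (pselect (exists2 y, P y & lt y x)) => [[y Py yx]|no]; first exact: IH Py.
by exists x => // y Py yx; apply: no; exists y.
Qed.

Lemma wo_nlt_lt x y z : ~ lt y x -> lt y z -> lt x z.
Proof.
move=> yx yz; case: (wo_total lt_wo x y) => [xy|->|//] //.
exact: (wo_trans lt_wo) yz.
Qed.

Lemma wo_lt_nlt x y z : lt x y -> ~ lt z y -> lt x z.
Proof.
move=> xy zy; case: (wo_total lt_wo z y) => [//|->|yz] //.
exact: (wo_trans lt_wo) yz.
Qed.

End WellOrder.

(** * Closure points of functions on a regular well-order *)

Section Regular.
Variables (X : Type) (lt : X -> X -> Prop).
Hypotheses (lt_wo : strict_wo lt) (lt_reg : regular lt).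

(** The closure points of a function form a club, so quantifying over [h] replaces quantifying over
    clubs. *)
Definition closed_under (h : X -> X) (d : X) := forall x, lt x d -> lt (h x) d.

Fixpoint below (d : X) (s : seq X) : Prop :=
  if s is a :: s' then lt a d /\ below d s' else True.

Lemma below_cat d s t : below d (s ++ t) <-> below d s /\ below d t.
Proof.
by elim: s => [|a s IH] /=; [tauto|rewrite IH; tauto].
Qed.

Lemma below_trans c d s : lt c d -> below c s -> below d s.
Proof.
move=> cd; elim: s => //= a s IH [ac cs]; split; last exact: IH.
exact: (wo_trans lt_wo ac cd).
Qed.

Lemma below_exists (d0 : X) s : exists c, below c s.
Proof.
elim: s => [|a s [c cs]] /=; first by exists d0.
have [e eP] := lt_reg.2 (fun n => if n is 0 then c else a).
exists e; split; [exact: (eP 1)|apply: below_trans cs; exact: (eP 0)].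
Qed.

Lemma bound2 (c d : X) : exists e, lt c e /\ lt d e.
Proof.
have [e eP] := lt_reg.2 (fun n => if n is 0 then c else d).
by exists e; split; [exact: (eP 0)|exact: (eP 1)].
Qed.

(* A diagonal intersection of countably many clubs is again a club. *)
Lemma closed_diag (h : nat -> X -> X -> X) : exists H, forall d,
  closed_under H d -> forall n y, lt y d -> closed_under (h n y) d.
Proof.
(* [~ lt x y] means that [y] is at most [x]: [H x] bounds the values at all arguments up to [x], and
   [H] is applied to the larger of [y] and [z]. *)
have /choice[H HP] x : exists c,
    forall n y z, ~ lt x y -> ~ lt x z -> lt (h n y z) c.
  have [x' x'P] := lt_reg.2 (fun=> x).
  have xx' y : ~ lt x y -> lt y x' := fun yx => wo_nlt_lt lt_wo yx (x'P 0).
  have /choice[g gP] n : exists c,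
      forall y z, ~ lt x y -> ~ lt x z -> lt (h n y z) c.
    have /choice[g gP] y : exists c, forall z, ~ lt x z -> lt (h n y z) c.
      have [c cP] := lt_reg.1 x' (h n y).
      by exists c => z /xx'; exact: cP.
    have [c cP] := lt_reg.1 x' g.
    exists c => y z /xx' yx /gP; move: (cP _ yx) => gc hg.
    exact: (wo_trans lt_wo (hg y) gc).
  have [c cP] := lt_reg.2 g.
  exists c => n y z xy xz; exact: (wo_trans lt_wo (gP n y z xy xz) (cP n)).
exists H => d dH n y yd z zd.
case: (wo_total lt_wo y z) => [yz|yz|zy].
- apply: (wo_trans lt_wo (HP z n y z _ _) (dH z zd)).
    exact: (wo_nltgt lt_wo).
  exact: (@wo_irr _ _ lt_wo).
- rewrite yz in yd *.
  by apply: (wo_trans lt_wo (HP z n z z _ _) (dH z zd)); exact: (@wo_irr _ _ lt_wo).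
- apply: (wo_trans lt_wo (HP y n y z _ _) (dH y yd)).
    exact: (@wo_irr _ _ lt_wo).
  exact: (wo_nltgt lt_wo).
Qed.

Lemma closed_countable (h : nat -> X -> X) : exists H, forall d,
  closed_under H d -> forall n, closed_under (h n) d.
Proof.
have [H HP] := closed_diag (fun n _ => h n).
by exists H => d /HP dH n x xd; exact: (dH n x xd).
Qed.

Lemma closed_pair (h1 h2 : X -> X) : exists H, forall d,
  closed_under H d -> closed_under h1 d /\ closed_under h2 d.
Proof.
have [H HP] := closed_countable (fun n => if n is 0 then h1 else h2).
by exists H => d /HP dH; split; [exact: (dH 0)|exact: (dH 1)].
Qed.

(** Induction on the length: regularity bounds the values over all heads below [x]. The countably
    many lengths are then bounded together. *)
Lemma seq_bound (x : X) (F : seq X -> X) :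
  exists c, forall s, below x s -> lt (F s) c.
Proof.
have bd n : forall F : seq X -> X,
    exists c, forall s, size s = n -> below x s -> lt (F s) c.
  elim: n => [|n IH] {}F.
    have [c cP] := lt_reg.2 (fun=> F [::]).
    by exists c => s /size0nil ->; move: (cP 0).
  have /choice[g gP] a := IH (fun s => F (a :: s)).
  have [c cP] := lt_reg.1 x g.
  exists c => -[//|a s] [] ss /= [ax sx].
  exact: (wo_trans lt_wo (gP a s ss sx) (cP a ax)).
have /choice[g gP] n := bd n F.
have [c cP] := lt_reg.2 g.
exists c => s sx; exact: (wo_trans lt_wo (gP _ s erefl sx) (cP _)).
Qed.

Lemma below_max d s : (exists x, lt x d) -> below d s ->
  exists2 y, lt y d & forall c, lt y c -> below c s.
Proof.
move=> [x xd]; elim: s => [_|a s IH /= [ad /IH [y yd yP]]]; first by exists x.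
case: (pselect (lt a y)) => ay.
  by exists y => // c yc; split; [exact: (wo_trans lt_wo ay)|exact: yP].
exists a => // c ac; split=> //; apply: yP; exact: (wo_nlt_lt lt_wo ay).
Qed.

(** [H x] bounds [F] on the sequences with entries up to [x]. It is applied to the largest entry of
    [s], or to any element below [d] if [s] is empty. *)
Lemma closed_seq (F : seq X -> X) : exists H, forall d,
  closed_under H d -> (exists x, lt x d) -> forall s, below d s -> lt (F s) d.
Proof.
have /choice[H HP] x : exists c, forall s,
    (forall e, lt x e -> below e s) -> lt (F s) c.
  have [x' [xx' _]] := bound2 x x; have [c cP] := seq_bound x' F.
  by exists c => s sP; apply/cP/sP.
exists H => d dH xd s sd; have [y yd yP] := below_max xd sd.
exact: (wo_trans lt_wo (HP y s yP) (dH y yd)).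
Qed.
End Regular.

(** * Cardinal comparison *)

Definition embeds (X Y : Type) : Prop := exists f : X -> Y, injective f.

Lemma embeds_trans Y X Z : embeds X Y -> embeds Y Z -> embeds X Z.
Proof. by move=> [f fI] [g gI]; exists (g \o f); exact: inj_comp. Qed.

Lemma embeds_refl X : embeds X X.
Proof. by exists id. Qed.

Lemma embeds_prod X Y Z T : embeds X Y -> embeds Z T -> embeds (X * Z) (Y * T).
Proof.
move=> [f fI] [g gI]; exists (fun p => (f p.1, g p.2)).
by move=> [a b] [c d] [/fI /= -> /gI /= ->].
Qed.

Lemma sval_inj X (P : X -> Prop) : injective (@sval X P).
Proof. by move=> [x Px] [y Py] /= e; subst y; rewrite (Prop_irrelevance Px Py). Qed.

Lemma embeds_sig X (P : X -> Prop) : embeds {x | P x} X.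
Proof. by exists sval; exact: sval_inj. Qed.

(** Transfinite recursion with choices: by the third hypothesis, the requirement at [x] sees only
    the earlier values. *)
Lemma choice_wf (X Y : Type) (lt : X -> X -> Prop) (P : X -> (X -> Y) -> Y -> Prop) :
  well_founded lt -> inhabited Y ->
  (forall x g h y, (forall z, lt z x -> g z = h z) -> P x g y -> P x h y) ->
  (forall x g, exists y, P x g y) ->
  exists g, forall x, P x g (g x).
Proof.
move=> wf [y0] Pext Pex.
have /choice[F FP] (p : X * (X -> Y)) : exists y, P p.1 p.2 y by exact: Pex.
pose glue x (rec : forall z, lt z x -> Y) z :=
  if pselect (lt z x) is left p then rec z p else y0.
pose g := Fix wf (fun=> Y) (fun x rec => F (x, glue x rec)).
exists g => x.
have -> : g x = F (x, glue x (fun z _ => g z)).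
  rewrite /g Fix_eq // => {}x f h fh; congr (F (x, _)); apply: funext => z.
  by rewrite /glue; case: pselect.
apply: Pext (FP (x, _)) => z zx; rewrite /= /glue; by case: pselect.
Qed.

Lemma wo_inverse_image X Y (lt : Y -> Y -> Prop) (f : X -> Y) :
  injective f -> strict_wo lt -> strict_wo (fun x y => lt (f x) (f y)).
Proof.
move=> fI [wf tr tot]; split.
- exact: wf_inverse_image.
- by move=> x y z; exact: tr.
- move=> x y; case: (tot (f x) (f y)) => [|/fI|];
    by [constructor 1|constructor 2|constructor 3].
Qed.

Lemma wo_exists X : exists lt : X -> X -> Prop, strict_wo lt.
Proof.
have [R Rwo] := well_ordering_principle {classic X}.
have least (P : X -> Prop) x : P x -> exists2 z, P z & forall y, P y -> R z y.
  move=> Px; have [|z [[zA zm] _]] := Rwo (fun x => `[< P x >]).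
    by exists x; exact/asboolP.
  by exists z => [|y Py]; [exact/asboolP|apply: zm; exact/asboolP].
have Ruq x y : R x y -> R y x -> x = y.
  move=> xy yx; have [|z [_ zu]] := Rwo (fun z => `[< z = x \/ z = y >]).
    by exists x; apply/asboolP; left.
  have rr z' : R z' z'.
    by have [w -> ww] := least (eq^~ z') _ erefl; exact: ww.
  rewrite -(zu x); first rewrite -(zu y) //.
    split; first by apply/asboolP; right.
    by move=> w /asboolP[->|->].
  split; first by apply/asboolP; left.
  by move=> w /asboolP[->|->].
pose lt x y := R x y /\ x <> y.
have tot x y : [\/ lt x y, x = y | lt y x].
  case: (pselect (x = y)) => [->|xy]; first by constructor 2.
  have [z [->|->] zm] := least (fun z => z = x \/ z = y) x (or_introl erefl).
    by constructor 1; split=> //; apply: zm; right.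
  by constructor 3; split=> [|/esym//]; apply: zm; left.
have wf : well_founded lt.
  move=> x; apply: contrapT => nx.
  have [z nz zm] := least (fun z => ~ Acc lt z) x nx.
  apply: nz; split=> y [yz ny]; apply: contrapT => /zm zy.
  by apply: ny; exact: Ruq.
exists lt; split=> // x y z xy yz.
case: (tot x z) => // [xz|zx].
  by subst z; case: xy yz => xy nxy [yx _]; case: nxy; exact: Ruq.
exfalso.
(* A cycle of three elements would have no least one. *)
have [w wP wm] := least (fun w => [\/ w = x, w = y | w = z]) x (Or31 _ _ erefl).
case: wP => e; subst w.
- by case: zx => zx nzx; apply: nzx; apply: Ruq => //; apply: wm; constructor 3.
- by case: xy => xy nxy; apply: nxy; apply: Ruq => //; apply: wm; constructor 1.
- by case: yz => yz nyz; apply: nyz; apply: Ruq => //; apply: wm; constructor 2.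
Qed.

Definition seg (X : Type) (lt : X -> X -> Prop) (a : X) : Type := {x | lt x a}.

Lemma seg_wo X (lt : X -> X -> Prop) a :
  strict_wo lt -> strict_wo (fun u v : seg lt a => lt (sval u) (sval v)).
Proof. by move=> ltwo; apply: wo_inverse_image ltwo; exact: sval_inj. Qed.

(** Give each [x] in turn an element of [Z] not given before. If this never fails, [X] embeds in
    [Z]; if it fails at [a], the values below [a] exhaust [Z]. *)
Lemma embeds_or_seg X (lt : X -> X -> Prop) Z : strict_wo lt ->
  embeds X Z \/ exists a, embeds Z (seg lt a).
Proof.
move=> ltwo; case: (pselect (inhabited Z)) => [inhZ|noZ]; last first.
  case: (pselect (inhabited X)) => [[x]|noX].
    by right; exists x, (fun z => False_rect _ (noZ (inhabits z))) => z; case: noZ.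
  by left; exists (fun x => False_rect _ (noX (inhabits x))) => x; case: noX.
pose new x (g : X -> Z) z := forall y, lt y x -> g y <> z.
have [|x g|g gP] := @choice_wf X Z lt
    (fun x g z => (exists z, new x g z) -> new x g z) (wo_wf ltwo) inhZ.
- move=> x g h z gh gP [w wP]; have /gP gz : exists z, new x g z.
    by exists w => y yx; rewrite gh //; exact: wP.
  by move=> y yx; rewrite -gh //; exact: gz.
- case: (pselect (exists z, new x g z)) => [[z zP]|no]; first by exists z.
  by case: inhZ => z; exists z => /no.
case: (pselect (forall x, exists z, new x g z)) => [always|/existsNP[a aP]].
  left; exists g => x y e; case: (wo_total ltwo x y) => // xy; exfalso.
    exact: (gP y (always y) x xy e).
  by apply: (gP x (always x) y xy); rewrite e.
right; exists a; suff /choice[f fP] z : exists y : seg lt a, g (sval y) = z.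
  by exists f => z w e; rewrite -(fP z) -(fP w) e.
apply: contrapT => no; apply: aP; exists z => y ya e.
by apply: no; exists (exist _ y ya).
Qed.

(** Well-order [X]: a type that does not receive an embedding of [X] embeds in a proper segment, and
    the induction runs over the endpoints of segments. *)
Lemma card_ind (P : Type -> Prop) :
  (forall X : Type, (forall Y : Type, ~ embeds X Y -> P Y) -> P X) ->
  forall X : Type, P X.
Proof.
move=> step X; have [lt ltwo] := wo_exists X.
suff segP a : forall Y : Type, embeds Y (seg lt a) -> P Y.
  by apply: step => Y XY; have [//|[a /segP]] := embeds_or_seg Y ltwo.
elim/(well_founded_ind (wo_wf ltwo)): a => a IH Y Ya.
apply: step => Z YZ; have [aZ|[b Zb]] := embeds_or_seg Z (seg_wo a ltwo).
  by case: YZ; exact: embeds_trans aZ.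
apply: (IH (sval b) (svalP b)); apply: embeds_trans Zb _.
exists (fun x : seg (fun u v : seg lt a => lt (sval u) (sval v)) b =>
  exist (fun y => lt y (sval b)) (sval (sval x)) (svalP x)).
by move=> x y [/sval_inj/sval_inj].
Qed.

(** The initial ordinal of [X]: if [X] embeds in proper segments, the order is pulled back from the
    shortest of them. *)
Lemma initial_wo X : exists lt : X -> X -> Prop,
  strict_wo lt /\ forall a, ~ embeds X (seg lt a).
Proof.
have [lt ltwo] := wo_exists X.
case: (pselect (exists a, embeds X (seg lt a))) => [[a0 Xa0]|no]; last first.
  by exists lt; split=> // a Xa; apply: no; exists a.
have [a [f fI] amin] := wo_least ltwo (P := fun a => embeds X (seg lt a)) Xa0.
have fI' : injective (fun x => sval (f x)) by move=> x y /sval_inj/fI.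
exists (fun x y => lt (sval (f x)) (sval (f y))); split.
  exact: (wo_inverse_image fI' ltwo).
move=> b Xb; apply: (amin (sval (f b)) _ (svalP (f b))); apply: embeds_trans Xb _.
exists (fun x : seg (fun u v => lt (sval (f u)) (sval (f v))) b =>
  exist (fun y => lt y (sval (f b))) (sval (f (sval x))) (svalP x)).
by move=> x y [/sval_inj/fI/sval_inj].
Qed.

(** Hilbert's hotel along a copy of [nat]. *)
Lemma embeds_option X : embeds nat X -> embeds (option X) X.
Proof.
move=> [g gI].
have /choice[k kP] x : exists o, if o is Some n then x = g n else forall n, x <> g n.
  case: (pselect (exists n, x = g n)) => [[n xn]|no]; first by exists (Some n).
  by exists None => n xn; apply: no; exists n.
exists (fun o => if o is Some x then if k x is Some n then g n.+1 else x else g 0).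
move=> [x|] [y|] //; last 2 first.
- by have := kP x; case: (k x) => [n _ /gI|no e] //; case: (no 0).
- by have := kP y; case: (k y) => [n _ /gI|no e] //; case: (no 0).
have := kP x; case: (k x) => [n ->|nx]; have := kP y; case: (k y) => [m ->|ny].
- by move=> /gI[->].
- by move=> /esym/ny.
- by move=> /nx.
- by move=> ->.
Qed.

Lemma embeds_nat_option X : embeds nat (option X) -> embeds nat X.
Proof.
move=> [f fI].
have [n0 n0P] : exists n0, forall n, f (n0 + n) <> None.
  case: (pselect (exists n, f n = None)) => [[n fn]|no].
    exists n.+1 => m; rewrite -fn => /fI /eqP.
    by rewrite addSn gtn_eqF // ltnS leq_addr.
  by exists 0 => n fn; apply: no; exists n.
have /choice[g gP] n : exists x, f (n0 + n) = Some x.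
  by have := n0P n; case: (f _) => // x _; exists x.
by exists g => n m e; apply/(@addnI n0)/fI; rewrite !gP e.
Qed.

Lemma embedsP X Y : embeds X Y <-> ([set: X] #<= [set: Y]).
Proof.
split=> [|/card_leP[f]]; last first.
  exists (fun x => val (f (SigSub (mem_set (I : [set: X] x))))) => x y /val_inj e.
  by have [] := @inj _ _ _ f _ _ (in_setT _) (in_setT _) e.
move=> [f fI]; elim/Ppointed: Y f fI => Y f fI.
  have -> : [set: X] = set0 by rewrite -subset0 => x _; case: (no (f x)).
  exact: card_ge0.
by apply/pcard_injP; exists f => x y _ _; exact: fI.
Qed.

Lemma Cantor_Bernstein_embeds X Y :
  embeds X Y -> embeds Y X -> exists f : X -> Y, bijective f.
Proof.
move=> /embedsP XY /embedsP YX.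
have /card_bijP[f [g fK gK]] := Cantor_Bernstein XY YX.
exists (fun x => val (f (SigSub (mem_set (I : [set: X] x))))).
exists (fun y => val (g (SigSub (mem_set (I : [set: Y] y))))) => x.
  rewrite [SigSub _](_ : _ = f (SigSub (mem_set (I : [set: X] x)))) ?fK //.
  exact: val_inj.
rewrite [SigSub _](_ : _ = g (SigSub (mem_set (I : [set: Y] x)))) ?gK //.
exact: val_inj.
Qed.

Lemma embeds_nat_prod X : embeds nat (X * X) -> embeds nat X.
Proof.
move=> /embedsP natX; apply/embedsP; apply: contrapT => /finite_setPn XF.
by apply/finite_setPn: natX; rewrite -setXTT; exact: finite_setX.
Qed.

(** Hessenberg's theorem by Goedel's order on pairs: first by maximum, then lexicographically. A
    proper segment then lies in the square of a closed segment of [X]. *)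
Lemma embeds_square X : embeds nat X -> embeds (X * X) X.
Proof.
elim/card_ind: X => X IH natX.
have [lt [ltwo lt0]] := initial_wo X.
pose mx (p : X * X) := if pselect (lt p.1 p.2) then p.2 else p.1.
have mxl p : ~ lt (mx p) p.1.
  rewrite /mx; case: pselect => [h|h] /=; first exact: (wo_nltgt ltwo h).
  exact: (wo_irr ltwo).
have mxr p : ~ lt (mx p) p.2 by rewrite /mx; case: pselect => //= h; exact: (wo_irr ltwo).
pose lt2 p q := lt (mx p) (mx q) \/ mx p = mx q /\
  (lt p.1 q.1 \/ p.1 = q.1 /\ lt p.2 q.2).
have lt2wo : strict_wo lt2.
  split.
  - move=> [a b]; move e : (mx (a, b)) => m.
    move: a b e; elim/(well_founded_ind (wo_wf ltwo)): m => m IHm a.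
    elim/(well_founded_ind (wo_wf ltwo)): a => a IHa b.
    elim/(well_founded_ind (wo_wf ltwo)): b => b IHb e.
    split=> -[c d] [|[e' [|[/= ca]]]].
    + by rewrite e => cdm; exact: IHm cdm _ _ erefl.
    + by move=> /= ca; apply: IHa => //; rewrite e'.
    + by rewrite ca in e' * => db; apply: IHb => //; rewrite e'.
  - move=> p q r [pq|[epq pq]] [qr|[eqr qr]].
    + by left; exact: (wo_trans ltwo) qr.
    + by left; rewrite -eqr.
    + by left; rewrite epq.
    + right; split; first by rewrite epq.
      case: pq => [pq|[p1 pq]]; case: qr => [qr|[q1 qr]].
      * by left; exact: (wo_trans ltwo) qr.
      * by left; rewrite -q1.
      * by left; rewrite p1.
      * by right; rewrite p1; split=> //; exact: (wo_trans ltwo) qr.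
  - move=> p q; case: (wo_total ltwo (mx p) (mx q)) => h;
      [by constructor 1; left| |by constructor 3; left].
    case: (wo_total ltwo p.1 q.1) => h1.
    + by constructor 1; right; split=> //; left.
    + case: (wo_total ltwo p.2 q.2) => h2.
      * by constructor 1; right; split=> //; right.
      * by constructor 2; rewrite [p]surjective_pairing h1 h2 -surjective_pairing.
      * by constructor 3; right; split=> //; right.
    + by constructor 3; right; split=> //; left.
(* Otherwise [X] embeds in [Y * Y]. The point [mx p] does not enlarge the infinite segment below it,
   which absorbs its square by induction. *)
have [//|[p Xp]] := embeds_or_seg X lt2wo.
pose Y := {x | ~ lt (mx p) x}.
have XYY : embeds X (Y * Y).
  apply: embeds_trans Xp _.
  have le (q : seg lt2 p) : ~ lt (mx p) (mx (sval q)).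
    case: q => q /= [qp|[-> _]]; last exact: (wo_irr ltwo).
    exact: (wo_nltgt ltwo).
  have inY (q : seg lt2 p) x : ~ lt (mx (sval q)) x -> ~ lt (mx p) x.
    by move=> qx px; apply: (le q); exact: wo_lt_nlt px qx.
  pose inl x : ~ lt (mx p) x -> Y := exist (fun x => ~ lt (mx p) x) x.
  exists (fun q => (inl _ (inY q _ (mxl _)), inl _ (inY q _ (mxr _)))).
  by move=> [[a b] abp] [[c d] cdp] [/= ac bd]; apply: sval_inj; rewrite /= ac bd.
have natY : embeds nat Y := embeds_nat_prod (embeds_trans natX XYY).
have YS : embeds Y (option (seg lt (mx p))).
  have /choice[f fP] (y : Y) : exists o : option (seg lt (mx p)),
      if o is Some x then sval x = sval y else sval y = mx p.
    case: (pselect (lt (sval y) (mx p))) => yp.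
      by exists (Some (exist (fun x => lt x (mx p)) _ yp)).
    exists None; case: (wo_total ltwo (sval y) (mx p)) => // py.
    by case: (svalP y).
  exists f => x y e; apply: sval_inj; have := fP x; have := fP y; rewrite e.
  by case: (f y) => [z <- <-|-> ->].
have natS : embeds nat (seg lt (mx p)) by apply/embeds_nat_option/embeds_trans/YS.
have YS' : embeds Y (seg lt (mx p)) := embeds_trans YS (embeds_option natS).
case: (lt0 (mx p)); apply: embeds_trans XYY _.
apply: embeds_trans (embeds_prod YS' YS') _.
exact: IH (lt0 _) natS.
Qed.

Lemma embeds_seq X : embeds nat X -> embeds (seq X) X.
Proof.
move=> natX; have [p pI] := embeds_square natX; have [n nI] := natX.
(* The length is stored as well, since the code [n 0] of the empty sequence may also be that of a
   pair. *)
pose code := foldr (fun a c => p (a, c)) (n 0).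
exists (fun s => p (n (size s), code s)) => s t /pI[/nI].
elim: s t => [|a s IH] [|b t] //= [st] /pI[-> cst].
by rewrite (IH t).
Qed.

(** * Branches over stationary sets *)

Section Extends.
Variable X : Type.
Implicit Types m s t : seq X.

(** The tree order: sequences grow at the head of the list, so their initial segments are
    suffixes. *)
Definition extends m s := exists u, s = u ++ m.

Lemma extends_refl m : extends m m.
Proof. by exists [::]. Qed.

Lemma extends_trans s m t : extends m s -> extends s t -> extends m t.
Proof. by move=> [u ->] [v ->]; exists (v ++ u); rewrite catA. Qed.

Lemma extends_size m s : extends m s -> size m <= size s.
Proof. by move=> [u ->]; rewrite size_cat leq_addl. Qed.

Lemma extends_eq m s : extends m s -> size s <= size m -> m = s.
Proof.
move=> [[|a u] ->] //; rewrite size_cat /= => /leq_trans/(_ (leq_addl (size u) _)).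
by rewrite addSn ltnn.
Qed.

Lemma extends_drop m s : extends m s -> m = drop (size s - size m) s.
Proof. by move=> [u ->]; rewrite size_cat addnK drop_size_cat. Qed.

Lemma extends_total m m' s :
  extends m s -> extends m' s -> size m <= size m' -> extends m m'.
Proof.
move=> [u ->] [u' e] le.
exists (take (size u - size u') m').
have := congr1 (drop (size u)) e; rewrite drop_size_cat // => em.
have su : size u' <= size u.
  have := congr1 size e; rewrite !size_cat => ee.
  by rewrite -(leq_add2r (size m)) ee leq_add2l.
by rewrite em drop_cat ltnNge su /= cat_take_drop.
Qed.

Lemma extends_cons_neq a b m s :
  extends (a :: m) s -> extends (b :: m) s -> a = b.
Proof.
move=> h1 h2; have := extends_total h1 h2 (leqnn _).
by move=> /extends_eq /(_ (leqnn _)) [].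
Qed.

End Extends.

(** * Ladders, stationary sets and the choice of branches *)

Section Ladder.
Variables (X : Type) (lt : X -> X -> Prop).
Hypotheses (lt_wo : strict_wo lt) (lt_reg : regular lt).

(** [f] is cofinal in [d] but need not increase. Successors have ladders too; the least element has
    none. *)
Definition ladder (d : X) (f : nat -> X) : Prop :=
  (forall n, lt (f n) d) /\ forall x, lt x d -> exists n, ~ lt (f n) x.

Lemma ladder_exists (x0 : X) (h : X -> X) :
  exists d, [/\ exists f, ladder d f, closed_under lt h d & lt x0 d].
Proof.
have /choice[k kP] x : exists y, lt x y /\ forall z, ~ lt x z -> lt (h z) y.
  have [x' [xx' _]] := bound2 lt_reg x x.
  have [c cP] := lt_reg.1 x' h; have [y [cy xy]] := bound2 lt_reg c x.
  exists y; split=> // z xz; apply: (wo_trans lt_wo _ cy); apply: cP.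
  exact: wo_nlt_lt xz xx'.
pose f n := iter n k x0.
have [c0 c0P] := lt_reg.2 f.
(* [d] is the supremum of the iterates of [k], which outgrows [h]. *)
have [d dP dmin] := wo_least lt_wo (P := fun d => forall n, lt (f n) d) c0P.
have cof x : lt x d -> exists n, ~ lt (f n) x.
  by move=> xd; apply/existsNP => fx; exact: (dmin x fx xd).
exists d; split; first by exists f.
- move=> x /cof[n fx]; exact: (wo_trans lt_wo ((kP (f n)).2 x fx) (dP n.+1)).
- exact: (dP 0).
Qed.

(** The least element is closed under every [h]; the sets considered below exclude it by asking for
    a ladder. *)
Definition stationary (A : X -> Prop) : Prop :=
  forall h, exists2 d, A d & closed_under lt h d.

(* Fodor's argument: otherwise, on a closed set avoiding all the fibres beyond
   the bounds, a ladder would stay below these bounds. *)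
Lemma stationary_split (L : X -> nat -> X) :
  (forall d, (exists f, ladder d f) -> ladder d (L d)) ->
  exists n, forall x, exists2 y, lt x y &
    stationary (fun d => ladder d (L d) /\ L d n = y).
Proof.
move=> LP; apply: contrapT => /forallNP no.
have /choice[x xP] n : exists x, forall y, lt x y ->
    ~ stationary (fun d => ladder d (L d) /\ L d n = y).
  by have /existsNP[x xP] := no n; exists x => y xy yS; apply: xP; exists y.
have /choice[h hP] n : exists h : X -> X -> X, forall y, lt (x n) y ->
    forall d, ladder d (L d) -> L d n = y -> ~ closed_under lt (h y) d.
  suff /choice[h hP] y : exists h : X -> X, lt (x n) y ->
      forall d, ladder d (L d) -> L d n = y -> ~ closed_under lt h d by exists h.
  case: (pselect (lt (x n) y)) => [/xP/existsNP[h hP]|nxy]; last by exists id.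
  by exists h => _ d Ld dy hd; apply: hP; exists d.
have [H HP] := closed_diag lt_wo lt_reg h.
have [x' x'P] := lt_reg.2 x.
have [d [/LP Ld /HP dH x'd]] := ladder_exists x' H.
have [n nP] := Ld.2 _ x'd.
have xL : lt (x n) (L d n) := wo_lt_nlt lt_wo (x'P n) nP.
exact: (hP n _ xL d Ld erefl) (dH n _ (Ld.1 n)).
Qed.

Lemma embeds_unbounded (A : X -> Prop) : (forall x, exists2 y, lt x y & A y) ->
  exists2 e : X -> X, injective e & forall x, A (e x).
Proof.
move=> Aunb; case: (pselect (inhabited X)) => [inhX|noX]; last first.
  by exists id => // x; case: noX.
have [|x g|e eP] := @choice_wf X X lt
    (fun x g z => A z /\ forall y, lt y x -> lt (g y) z) (wo_wf lt_wo) inhX.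
- by move=> x g h z gh [Az zP]; split=> // y yx; rewrite -gh //; exact: zP.
- have [c cP] := lt_reg.1 x g; have [z cz Az] := Aunb c.
  exists z; split=> // y yx; exact: (wo_trans lt_wo (cP y yx) cz).
exists e; last by move=> x; exact: (eP x).1.
move=> x y exy; case: (wo_total lt_wo x y) => // xy; exfalso.
  by have := (eP y).2 x xy; rewrite exy; exact: wo_irr.
by have := (eP x).2 y xy; rewrite exy; exact: wo_irr.
Qed.

(** Each sequence [s] is coded by a value whose fibre under the [n]-th ladder entry is stationary.
    Those [d] of this fibre that exceed all entries of [s] get the branch that starts with [s] and
    continues along the ladder of [d]. *)
Lemma branches_exist : embeds (seq X) X ->
  exists (D : Type) (top : D -> X) (on : D -> seq X -> Prop),
    [/\ injective top,
        forall d s t, on d s -> on d t -> size s <= size t -> extends s t,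
        forall d s t, extends s t -> on d t -> on d s
      & forall d n, exists2 s, on d s & size s = n] /\
    [/\ forall d s, on d s -> below lt (top d) s,
        forall d x, lt x (top d) -> exists2 s, on d s & ~ below lt x s
      & forall s h, exists2 d, on d s & closed_under lt h (top d)].
Proof.
move=> [c cI].
have /choice[L LP] d : exists g, (exists f, ladder d f) -> ladder d g.
  by case: (pselect (exists f, ladder d f)) => [[f fP]|no]; [exists f|exists (fun=> d)].
have [n /embeds_unbounded[e eI eP]] := stationary_split LP.
pose j s := e (c s).
have jI : injective j by move=> s t /eI/cI.
pose D := {d | ladder d (L d) /\ exists2 v, below lt d v & j v = L d n}.
have /choice[stem stemP] (d : D) : exists v, below lt (sval d) v /\ j v = L (sval d) n.
  by case: (svalP d) => _ [v]; exists v.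
pose fl (f : nat -> X) := fix fl k := if k is k'.+1 then f k' :: fl k' else [::].
pose node (d : D) k := fl (L (sval d)) k ++ stem d.
have fl_ext f k k' : k <= k' -> extends (fl f k) (fl f k').
  elim: k' => [|k' IH]; first by rewrite leqn0 => /eqP->; exact: extends_refl.
  rewrite leq_eqVlt ltnS => /orP[/eqP->|/IH kk']; first exact: extends_refl.
  by apply: extends_trans kk' _; exists [:: f k'].
have node_ext d k k' : k <= k' -> extends (node d k) (node d k').
  by move=> /(fl_ext (L (sval d)))[u e']; exists u; rewrite /node e' catA.
have fl_size f k : size (fl f k) = k by elim: k => //= k ->.
exists D, sval, (fun d s => exists k, extends s (node d k)).
split; split.
- exact: sval_inj.
- move=> d s t [k sk] [k' tk'] st;
    apply: (@extends_total _ s t (node d (maxn k k'))) => //.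
    by apply: extends_trans sk _; exact/node_ext/leq_maxl.
  by apply: extends_trans tk' _; exact/node_ext/leq_maxr.
- by move=> d s t st [k tk]; exists k; exact: extends_trans tk.
- move=> d m; exists (drop (size (node d m) - m) (node d m)).
    by exists m, (take (size (node d m) - m) (node d m)); rewrite cat_take_drop.
  rewrite size_drop subKn // /node size_cat fl_size; exact: leq_addr.
- move=> d s [k [u e']]; have : below lt (sval d) (node d k).
    apply/below_cat; split; last exact: (stemP d).1.
    elim: k {e'} => //= k IH; split=> //; exact: (svalP d).1.1.
  by rewrite e' => /below_cat[].
- move=> d x /((svalP d).1.2)[k Lx]; exists (node d k.+1).
    by exists k.+1; exact: extends_refl.
  by move=> [].
- move=> s h.
  have [x0 _] : exists x0 : X, True by exists (c s).
  have [z zs] := below_exists lt_wo lt_reg x0 s.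
  (* Closure under the constant [z] puts [d] beyond [z], hence beyond the entries of [s]. *)
  have [H HP] := closed_pair lt_wo lt_reg h (fun=> z).
  have [d [Ld dn] /HP[hd zd]] := eP (c s) H.
  have dP : ladder d (L d) /\ exists2 v, below lt d v & j v = L d n.
    split=> //; exists s; last exact: esym.
    exact: (below_trans lt_wo (zd _ (Ld.1 0)) zs).
  exists (exist _ d dP) => //; exists 0.
  suff -> : s = stem (exist _ d dP) by exact: extends_refl.
  by apply: jI; rewrite (stemP _).2 /= dn.
Qed.

End Ladder.

(** * Rigidity of the tree with peaks *)

Definition conn (V : Type) (E : V -> V -> Prop) (A : set V) : Prop :=
  forall x y, A x -> A y ->
    clos_refl_trans V (fun u v => [/\ A u, A v & E u v]) x y.

Definition model (V : Type) (E : V -> V -> Prop) (B : V -> set V) : Prop :=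
  [/\ forall v, B v !=set0,
      forall v, conn E (B v),
      forall u v x, B u x -> B v x -> u = v
    & forall u v, E u v -> exists x y, [/\ B u x, B v y & E x y]].

(** As branch sets are nonempty, this makes every [B v] the singleton of [v]. *)
Definition rigid (V : Type) (E : V -> V -> Prop) : Prop :=
  forall B, model E B -> forall v x, B v x -> x = v.

Lemma conn_ind (V : Type) (E : V -> V -> Prop) (A : set V) (P : V -> Prop) x :
  conn E A -> A x -> P x ->
  (forall y z, A y -> A z -> E y z -> P y -> P z) ->
  forall y, A y -> P y.
Proof.
move=> cA Ax Px step y Ay.
elim: (cA x y Ax Ay) Px => {x y Ax Ay} [x y [Ax Ay Exy]|//|x y z _ IH1 _ IH2].
- exact: step.
- by move=> /IH1/IH2.
Qed.

Section Tree.
Variables (X : Type) (lt : X -> X -> Prop) (lab : seq X -> X).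
Variables (U : X -> Type) (R : forall i, U i -> U i -> Prop).
Variables (D : Type) (top : D -> X) (on : D -> seq X -> Prop).
Hypotheses (lt_wo : strict_wo lt) (lt_reg : regular lt).
Hypothesis lab_cons : forall a s, lab (a :: s) = a.
Hypothesis R_rigid : forall i, rigid (@R i).
(** The graph attached to [s] is [U (lab s)]. So the children of any node carry a copy of every
    [U i], together too many for a single [U j]. *)
Hypothesis U_small : forall j (f : {i & U i} -> U j), inhabited (U j) -> ~ injective f.
Hypothesis top_inj : injective top.
Hypothesis on_total : forall d s t,
  on d s -> on d t -> size s <= size t -> extends s t.
Hypothesis on_down : forall d s t, extends s t -> on d t -> on d s.
Hypothesis on_long : forall d n, exists2 s, on d s & size s = n.
Hypothesis on_below : forall d s, on d s -> below lt (top d) s.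
Hypothesis on_cofinal : forall d x, lt x (top d) -> exists2 s, on d s & ~ below lt x s.
Hypothesis on_many : forall s h, exists2 d, on d s & closed_under lt h (top d).

(* A node is a sequence written in reverse order, so that its children are
   obtained by [cons]. *)
Inductive vertex : Type :=
| node of seq X
| peak of D
| cell s of U (lab s).

Definition tree_adj (x y : vertex) : Prop :=
  match x, y with
  | node s, peak d | peak d, node s => on d s
  | node s, cell t _ | cell t _, node s => s = t
  | cell s u, cell t v => exists e : s = t, R (eq_rect s (fun r => U (lab r)) u t e) v
  | _, _ => False
  end.

Definition above (m : seq X) (x : vertex) : Prop :=
  match x with
  | node s => extends m s
  | peak d => on d m
  | @cell s _ => extends m s
  end.

Definition in_cell s (x : vertex) : Prop :=
  if x is @cell t _ then s = t else False.

Lemma cell_inj s : injective (@cell s).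
Proof.
move=> u v h.
pose P x := if x is @cell t w
  then exists e : s = t, eq_rect s (fun r => U (lab r)) u t e = w else True.
have : P (cell v) by rewrite -h; exists erefl.
by case=> e; rewrite (Prop_irrelevance e erefl).
Qed.

(** Were the tops distinct, the branch with the larger top would contain a node not below the
    smaller one; comparing nodes of equal length, this node would be on both branches. *)
Lemma peak_eq d e : (forall s, on d s -> on e s) -> d = e.
Proof.
move=> de; apply: top_inj.
case: (wo_total lt_wo (top d) (top e)) => // h; [exfalso|exfalso].
  have [s es] := on_cofinal h; have [t dt ts] := on_long d (size s).
  have <- : t = s by apply: extends_eq (on_total (de _ dt) es _) _; rewrite ts.
  by case; exact: on_below.
have [s ds] := on_cofinal h; case; exact/on_below/de.
Qed.

(** The branch of [d] is infinite, whereas [s] has only [size s + 1] initial segments. *)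
Lemma on_pigeonhole d s (f : seq X -> seq X) : injective f ->
  ~ (forall t, on d t -> extends (f t) s).
Proof.
move=> finj fP.
have /choice[c cP] n : exists t, on d t /\ size t = n.
  by have [t] := on_long d n; exists t.
have fc (i : 'I_(size s).+2) : size (f (c i)) < (size s).+1.
  by rewrite ltnS; apply/extends_size/fP; exact: (cP i).1.
have /leq_card : injective (fun i => Ordinal (fc i)).
  move=> i j /(congr1 val) /= e; apply/val_inj => /=.
  rewrite -(cP i).2 -(cP j).2; congr (size _); apply: finj.
  by rewrite (extends_drop (fP _ (cP i).1)) (extends_drop (fP _ (cP j).1)) e.
by rewrite !card_ord ltnn.
Qed.

(** The part above [m] can only be left through a peak, towards a node of its branch shorter than
    [m]. *)
Lemma conn_above A m : conn tree_adj A -> A (node m) ->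
  (forall s, A (node s) -> size m <= size s) -> forall x, A x -> above m x.
Proof.
move=> cA Am mmin; apply: (conn_ind cA Am) => [|x y Ax Ay]; first exact: extends_refl.
case: x Ax => [s|d|s u] Ax; case: y Ay => [t|e|t v] Ay //=.
- by move=> os ms; exact: on_down os.
- by move=> <-.
- by move=> dt dm; apply: on_total dt _ => //; exact: mmin.
- by move=> ->.
- by move=> [e _]; rewrite e.
Qed.

Lemma conn_in_cell A s x : conn tree_adj A -> ~ A (node s) -> A x -> in_cell s x ->
  forall y, A y -> in_cell s y.
Proof.
move=> cA As Ax xs; apply: (conn_ind cA Ax xs) => y z Ay Az.
case: y Ay => [t|e|t v] Ay //=; case: z Az => [r|e|r w] Az //=.
- by move=> rt st; case: As; rewrite st -rt.
- by move=> [e _]; rewrite e.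
Qed.

Lemma conn_peak A d : conn tree_adj A -> (forall s, ~ A (node s)) -> A (peak d) ->
  forall y, A y -> y = peak d.
Proof.
move=> cA As Ad; apply: (conn_ind cA Ad) => // y z Ay Az Eyz yd.
by move: Eyz; rewrite yd; case: z Az => //= s /As.
Qed.

(** The higher end of the edge is above both [m] and [m'], and the nodes below a vertex form a
    chain. *)
Lemma adj_above x y m m' : tree_adj x y -> above m x -> above m' y ->
  extends m m' \/ extends m' m.
Proof.
have total d s t : on d s -> on d t -> extends s t \/ extends t s.
  move=> ds dt; case: (leqP (size s) (size t)) => st.
    by left; exact: on_total ds dt st.
  by right; exact: on_total dt ds (ltnW st).
have etotal r s t : extends s r -> extends t r -> extends s t \/ extends t s.
  move=> ds dt; case: (leqP (size s) (size t)) => st.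
    by left; exact: extends_total ds dt st.
  by right; exact: extends_total dt ds (ltnW st).
case: x => [s|d|s u]; case: y => [t|e|t v] //=.
- by move=> es ms; apply: total; exact: on_down es.
- by move=> <-; exact: etotal.
- by move=> dt dm mt; apply: total dm _; exact: on_down dt.
- by move=> ->; exact: etotal.
- by move=> [e _]; rewrite -e; exact: etotal.
Qed.

Section Model.
Variable B : vertex -> set vertex.
Hypothesis B_model : model tree_adj B.

Let B_ne v : B v !=set0. Proof. by case: B_model. Qed.
Let B_conn v : conn tree_adj (B v). Proof. by case: B_model. Qed.
Let B_disj u v x : B u x -> B v x -> u = v.
Proof. by case: B_model => _ _ + _; apply. Qed.
Let B_adj u v : tree_adj u v -> exists x y, [/\ B u x, B v y & tree_adj x y].
Proof. by case: B_model => _ _ _; apply. Qed.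

(* The neighbours of [node s] include uncountably many peaks, whereas a single
   peak is adjacent to countably many branch sets only. *)
Lemma node_not_peak s d : ~ (forall x, B (node s) x -> x = peak d).
Proof.
move=> Bs.
have /choice[c cP] n : exists t, on d t /\ size t = n.
  by have [t] := on_long d n; exists t.
have /choice[g gP] n : exists y, forall e, B (peak e) (node (c n)) -> y = top e.
  case: (pselect (exists e, B (peak e) (node (c n)))) => [[e eP]|no].
    by exists (top e) => e' /(B_disj eP)[->].
  by exists (top d) => e eP; case: no; exists e.
have [y yP] := lt_reg.2 g.
have [e es ecl] := on_many s (fun=> y).
have [x [z [Bx Bz Exz]]] := B_adj (es : tree_adj (node s) (peak e)).
move: Exz; rewrite (Bs _ Bx); case: z Bz => //= t Bt dt.
have tc : t = c (size t).
  apply: extends_eq; last by rewrite (cP _).2.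
  by apply: on_total dt (cP _).1 _; rewrite (cP _).2.
(* Closure under the constant [y] says something only once an element [a] below [top e] is at
   hand. *)
have [t1 et1 st1] := on_long e 1.
case: t1 st1 et1 => [//|a [|//]] _ /on_below /= [ae _].
have ye := ecl a ae; have := yP (size t).
rewrite (gP _ e); last by rewrite -tc.
exact: wo_nltgt ye.
Qed.

(** [node t] separates its cells from all else, so being confined to them spreads from [node s]
    along edges, except to the vertex whose branch set contains [node t], if there is one. This
    would confine a copy of every [U i] to [U (lab t)]. *)
Lemma node_not_cell s t : ~ (forall x, B (node s) x -> in_cell t x).
Proof.
move=> Bs.
pose cut x := B x (node t).
have step x y : ~ cut y -> tree_adj x y ->
    (forall z, B x z -> in_cell t z) -> forall z, B y z -> in_cell t z.
  move=> cy Exy Bx; have [a [b [Ba Bb Eab]]] := B_adj Exy.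
  have := Bx _ Ba; case: a Ba Eab => //= r u _ Eab tr.
  apply: (conn_in_cell (B_conn (v := y)) cy Bb).
  case: b Bb Eab => //= [r' Br' rr'|r' v _ [e _]]; last by rewrite -e.
  by case: cy; rewrite /cut tr -rr'.
have scut : ~ cut (node s) by move/Bs.
have [x0 _] : exists x0 : X, True.
  have [d _ _] := on_many [::] id; by exists (top d).
(* Of two children of [s], one is not below the cut vertex if that is a node or a cell. A cut peak
   is avoided later, by the choice of [d]. *)
have [a aP] : exists a, forall x, cut x -> ~ above (a :: s) x \/ exists d, x = peak d.
  have [a [_ ]] := bound2 lt_reg x0 x0 => _.
  case: (pselect (exists y, cut y)) => [[y cy]|no]; last first.
    by exists a => x cx; case: no; exists x.
  have cut1 x : cut x -> x = y by move=> cx; exact: B_disj cx cy.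
  have [b [ab _]] := bound2 lt_reg a a.
  case: (pselect (above (a :: s) y)) => [ya|ya]; last first.
    by exists a => x /cut1 ->; left.
  case: y cy cut1 ya => [r|d|r u] cy cut1 ya.
  - exists b => x /cut1 ->; left=> yb; have e := extends_cons_neq ya yb.
    by rewrite e in ab; exact: (wo_irr lt_wo ab).
  - by exists a => x /cut1 ->; right; exists d.
  - exists b => x /cut1 ->; left=> yb; have e := extends_cons_neq ya yb.
    by rewrite e in ab; exact: (wo_irr lt_wo ab).
pose r i := i :: a :: s.
have rs i : extends s (r i) by exists [:: i; a].
have ar i : extends (a :: s) (r i) by exists [:: i].
have inr i : forall z, B (node (r i)) z -> in_cell t z.
  have [y yP] : exists y, forall d, cut (peak d) -> y = top d.
    case: (pselect (exists d, cut (peak d))) => [[d dP]|no].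
      by exists (top d) => d' /(B_disj dP)[->].
    by exists x0 => d dP; case: no; exists d.
  have [y' [yy' _]] := bound2 lt_reg y y.
  (* The way from [node s] to [node (r i)] leads through [peak d], which is not cut as its top
     exceeds [y]. *)
  have [d dr dcl] := on_many (r i) (fun=> y').
  have ds : on d s := on_down (rs i) dr.
  have ndr : ~ cut (node (r i)).
    by move=> /aP [|[]//]; apply; exact: ar.
  have nd : ~ cut (peak d).
    move=> /yP yd; have /dcl : lt i (top d) by have [] := on_below dr.
    by rewrite -yd; exact: wo_nltgt.
  apply: (step (peak d) _ ndr dr).
  exact: (step (node s) _ nd ds).
have incell i (u : U (lab (r i))) : forall z, B (cell u) z -> in_cell t z.
  apply: (step (node (r i))) (inr i) => //.
  by move=> /aP [|[]//]; apply; exact: ar.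
pose tr i (w : U i) := eq_rect_r U w (lab_cons i (a :: s)).
have tr_inj i : injective (tr i).
  have inj j k (e : j = k) : injective (fun w : U k => eq_rect_r U w e).
    by move=> w w'; case: _ / e w w'.
  exact: inj.
have /choice[f fP] (p : {i & U i}) : exists v : U (lab t),
    B (@cell (r (projT1 p)) (tr _ (projT2 p))) (cell v).
  have [z Bz] := B_ne (@cell (r (projT1 p)) (tr _ (projT2 p))).
  have := incell _ _ z Bz; case: z Bz => //= t' v Bv tt'.
  by subst t'; exists v.
have inhU : inhabited (U (lab t)).
  have [z Bz] := B_ne (node s); have := Bs z Bz.
  by case: z {Bz} => //= t' v ->; constructor.
apply: (U_small (f := f) inhU) => -[i w] [i' w'] e.
have Bu := fP (existT _ i w); have := fP (existT _ i' w').
rewrite -e => /(B_disj Bu) /= ee.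
have ii : i = i' by case: ee.
by subst i'; rewrite (tr_inj _ _ _ (cell_inj ee)).
Qed.

(** A connected set without nodes is a single peak or lies among the cells at one node; both have
    been excluded. *)
Lemma node_in_branch s : exists m, B (node s) (node m) /\
  forall t, B (node s) (node t) -> size m <= size t.
Proof.
case: (pselect (exists t, B (node s) (node t))) => [[t Bt]|no].
  pose P n := `[< exists2 m, B (node s) (node m) & size m = n >].
  have exP : exists n, P n by exists (size t); apply/asboolP; exists t.
  case: (ex_minnP exP) => n /asboolP[m Bm <-] mmin.
  by exists m; split=> // r Br; apply/mmin/asboolP; exists r.
have no' r : ~ B (node s) (node r) by move=> Br; apply: no; exists r.
have [x Bx] := B_ne (node s); exfalso.
case: x Bx => [r /no'|d Bd|r u Bu] //.
  apply: (@node_not_peak s d); exact: conn_peak Bd.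
apply: (@node_not_cell s r); exact: conn_in_cell Bu _.
Qed.

Section Minimum.
Variable phi : seq X -> seq X.
Hypothesis phi_branch : forall s, B (node s) (node (phi s)).
Hypothesis phi_min : forall s t, B (node s) (node t) -> size (phi s) <= size t.

Lemma phi_inj : injective phi.
Proof.
move=> s t e; have := phi_branch s; rewrite e => /B_disj/(_ (phi_branch t)).
by case.
Qed.

Lemma phi_above s x : B (node s) x -> above (phi s) x.
Proof. exact: conn_above (phi_branch s) (@phi_min s) x. Qed.

(** If [B (peak d)] contains a node, its least one is comparable with every [phi t] by adjacency.
    Otherwise it is a single peak, or lies among the cells at one node [r], and then all [phi t]
    would be initial segments of [r]. *)
Lemma peak_branch d :
  (exists2 m, B (peak d) (node m) &
     forall t, on d t -> extends (phi t) m \/ extends m (phi t)) \/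
  (exists e, [/\ B (peak d) (peak e), forall x, B (peak d) x -> x = peak e
     & forall t, on d t -> on e (phi t)]).
Proof.
have adj t : on d t -> exists x y,
    [/\ B (peak d) x, B (node t) y & tree_adj x y].
  by move=> dt; apply: B_adj.
case: (pselect (exists m, B (peak d) (node m))) => [[m0 Bm0]|no].
  left; pose P n := `[< exists2 m, B (peak d) (node m) & size m = n >].
  have exP : exists n, P n by exists (size m0); apply/asboolP; exists m0.
  case: (ex_minnP exP) => n /asboolP[m Bm <-] mmin.
  exists m => // t /adj[x [y [Bx By Exy]]].
  have /(_ x Bx) mx := conn_above (B_conn (v := peak d)) Bm
    (fun r Br => mmin _ (introT (asboolP _) (ex_intro2 _ _ r Br erefl))).
  have := adj_above Exy mx (phi_above By); tauto.
have no' r : ~ B (peak d) (node r) by move=> Br; apply: no; exists r.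
have [x Bx] := B_ne (peak d); case: x Bx => [r /no'|e Be|r u Bu] //.
  right; exists e; have Ball := conn_peak (B_conn (v := peak d)) no' Be.
  split=> // t /adj[x [y [/Ball -> /phi_above By]]].
  by case: y By => //= r tr er; exact: on_down er.
exfalso; apply: (@on_pigeonhole d r phi phi_inj) => t /adj[x [y [Bx By]]].
have := conn_in_cell (B_conn (v := peak d)) (no' r) Bu erefl Bx.
have := phi_above By.
case: x Bx => //= r' v _; case: y By => //= r'' => [_|w _]; first by move=> + -> <-.
by move=> tr rr [e _]; rewrite rr e.
Qed.

(** Closure under [F1] keeps [phi t] below [top d], closure under [F2] keeps nodes below [top d] out
    of [B (peak d)], and closure under [h] keeps out peaks with a smaller top. *)
Lemma peak_closed : exists H, forall d, closed_under lt H (top d) ->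
  (forall x, B (peak d) x -> x = peak d) /\ forall t, on d t -> on d (phi t).
Proof.
have /choice[F1 F1P] s : exists c, below lt c (phi s).
  have [d0 _ _] := on_many [::] id.
  by exact: (below_exists lt_wo lt_reg (top d0)).
have /choice[F2 F2P] s : exists c, forall d, B (peak d) (node s) -> c = top d.
  case: (pselect (exists d, B (peak d) (node s))) => [[d Bd]|no].
    by exists (top d) => e /(B_disj Bd)[->].
  by exists (F1 s) => e Be; case: no; exists e.
have /choice[h hP] x : exists c, forall d e,
    top e = x -> B (peak d) (peak e) -> c = top d.
  case: (pselect (exists d, exists2 e, top e = x & B (peak d) (peak e)))
    => [[d [e ex Bd]]|no].
    exists (top d) => d' e' e'x; have -> : e' = e by apply: top_inj; rewrite ex.
    by move=> /(B_disj Bd)[->].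
  by exists x => d e ex Be; case: no; exists d, e.
have [H1 H1P] := closed_seq lt_wo lt_reg F1.
have [H2 H2P] := closed_seq lt_wo lt_reg F2.
have [H12 H12P] := closed_pair lt_wo lt_reg H1 H2.
have [H HP] := closed_pair lt_wo lt_reg H12 h.
exists H => d /HP[/H12P[/H1P d1 /H2P d2] d3].
have dne : exists x, lt x (top d).
  by have [[|a s] // /on_below /= [ad _] _] := on_long d 1; exists a.
have {}d1 t : on d t -> below lt (top d) (phi t).
  move=> /on_below /(d1 dne) td; exact (below_trans lt_wo td (F1P t)).
have {}d2 m : B (peak d) (node m) -> ~ below lt (top d) m.
  by move=> /F2P e /(d2 dne); rewrite e; exact: wo_irr.
have [[m Bm mP]|[e [Be Ball eP]]] := peak_branch d.
  exfalso; apply: (@on_pigeonhole d m phi phi_inj) => t dt.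
  have [//|[u e]] := mP t dt; case: (d2 m Bm).
  by have := d1 t dt; rewrite e => /below_cat[].
suff de : d = e by subst e.
apply: top_inj; case: (wo_total lt_wo (top d) (top e)) => // de; exfalso.
  (* [s] is on the branch of [e] but not below [top d], while every [phi t] is both; so all [phi t]
     are initial segments of [s]. *)
  have [s es sd] := on_cofinal de.
  apply: (@on_pigeonhole d s phi phi_inj) => t dt.
  case: (leqP (size (phi t)) (size s)) => ts; first exact: on_total (eP t dt) es ts.
  have [u e'] := on_total es (eP t dt) (ltnW ts).
  by case: sd; have := d1 t dt; rewrite e' => /below_cat[].
have := d3 _ de; rewrite (hP _ d e erefl Be); exact: wo_irr.
Qed.

Lemma phi_id s : phi s = s.
Proof.
have [H HP] := peak_closed.
have prefix t : extends (phi t) t.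
  have [d _ _] := on_many [::] id.
  (* Any two distinct elements serve here: a [phi t] longer than [t] would extend both children of
     [t]. *)
  have [a [da _]] := bound2 lt_reg (top d) (top d).
  have [d1 dd1 /HP[_ /(_ t) P1]] := on_many (a :: t) H.
  have [d2 dd2 /HP[_ /(_ t) P2]] := on_many (top d :: t) H.
  have t1 : on d1 t by apply: on_down dd1; exists [:: a].
  have t2 : on d2 t by apply: on_down dd2; exists [:: top d].
  case: (leqP (size (phi t)) (size t)) => st; first exact: on_total (P1 t1) t1 st.
  have e := extends_cons_neq (on_total dd1 (P1 t1) st) (on_total dd2 (P2 t2) st).
  by move: da; rewrite e => /(wo_irr lt_wo).
(* If [phi s] is shorter than [s], induction gives [phi (phi s) = phi s], and injectivity
   concludes. *)
have [n] := ubnP (size s); elim: n s => // n IH s sn.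
case: (leqP (size s) (size (phi s))) => ss; first exact: extends_eq.
by apply/phi_inj/IH; exact: leq_trans ss _.
Qed.

Lemma node_fixed s : B (node s) (node s).
Proof. by have := phi_branch s; rewrite phi_id. Qed.

(** All nodes are in their own branch sets, so [B (peak d)] is a single peak [e], whose branch
    contains that of [d]. *)
Lemma peak_fixed d x : B (peak d) x -> x = peak d.
Proof.
have [[m Bm _]|[e [_ Ball eP]]] := peak_branch d.
  by have := B_disj Bm (node_fixed m).
have de : d = e by apply: peak_eq => s /eP; rewrite phi_id.
by subst e; exact: Ball.
Qed.

Lemma peak_only v d : B v (peak d) -> v = peak d.
Proof.
have [x Bx] := B_ne (peak d); have e := peak_fixed Bx.
by rewrite e in Bx; move/B_disj; apply.
Qed.

Lemma node_cell s x : B (node s) x -> x = node s \/ in_cell s x.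
Proof.
move: x; apply: (conn_ind (B_conn (v := node s)) (node_fixed s)); first by left.
move=> y z By Bz Eyz yP; case: z Bz Eyz => [t Bt _|d /peak_only //|t v Bv Eyz].
  by left; have [->] := B_disj Bt (node_fixed t).
right; case: yP => [ey|]; first by move: Eyz; rewrite ey.
by case: y {By} Eyz => //= r u [e _]; rewrite -e.
Qed.

Lemma cell_cell s (u : U (lab s)) x : B (cell u) x -> in_cell s x.
Proof.
have [y [z [By Bz Eyz]]] := B_adj (erefl : tree_adj (node s) (cell u)).
have nonode r : ~ B (cell u) (node r) by move=> /B_disj/(_ (node_fixed r)).
suff zs : in_cell s z by exact: conn_in_cell (nonode s) Bz zs x.
case: z Bz Eyz => [r /nonode|d /peak_only|r v Bv] //= Eyz.
case: (node_cell By) => [ey|]; first by move: Eyz; rewrite ey.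
by case: y {By} Eyz => //= t w [e _]; rewrite -e.
Qed.

(** Restricted to the cells at [s], [B] is a model of the rigid graph [R (lab s)] in itself. *)
Lemma cell_fixed s (u : U (lab s)) x : B (cell u) x -> x = cell u.
Proof.
pose C (u v : U (lab s)) := B (cell u) (cell v).
have CM : model (@R (lab s)) C.
  split.
  - move=> v; have [z Bz] := B_ne (cell v); have := cell_cell Bz.
    by case: z Bz => //= t w Bw st; subst t; exists w.
  - move=> v w w' Bw Bw'.
    pose P x := exists2 w', x = cell w' &
      clos_refl_trans (U (lab s)) (fun a b => [/\ C v a, C v b & R a b]) w w'.
    have : P (cell w').
      move: Bw'; apply: (conn_ind (B_conn (v := cell v)) Bw (P := P)).
        by exists w => //; exact: rt_refl.
      move=> y z By Bz Eyz [a ey Ca]; subst y.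
      have := cell_cell Bz; case: z Bz Eyz => //= t b Bb [e Rab] st.
      subst t; exists b => //; apply: rt_trans Ca _; apply: rt_step.
      by split=> //; rewrite (Prop_irrelevance e erefl) in Rab.
    by case=> b /cell_inj ->.
  - by move=> v w a Ba /(B_disj Ba) /cell_inj.
  - move=> v w Rvw.
    have [y [z [By Bz Eyz]]] : exists x y,
      [/\ B (cell v) x, B (cell w) y & tree_adj x y].
      by apply: B_adj; exists erefl.
    have := cell_cell Bz; have := cell_cell By.
    case: y By Eyz => //= t a Ba; case: z Bz => //= t' b Bb [e Rab] st st'.
    by subst t; subst t'; exists a, b.
move=> Bx; have := cell_cell Bx; case: x Bx => //= t v Bv st; subst t.
by rewrite (R_rigid CM Bv).
Qed.

Lemma node_only s x : B (node s) x -> x = node s.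
Proof.
move=> Bx; case: (node_cell Bx) => //.
case: x Bx => //= t u Bu st; have [y By] := B_ne (cell u).
by have e := cell_fixed By; rewrite e in By; have := B_disj Bu By.
Qed.

End Minimum.

Lemma model_fixed v x : B v x -> x = v.
Proof.
have /choice[phi phiP] := node_in_branch.
have phi1 s := (phiP s).1; have phi2 s := (phiP s).2.
case: v => [s|d|s u].
- exact: node_only phi1 phi2 _ _.
- exact: peak_fixed phi1 phi2 _ _.
- exact: cell_fixed phi1 phi2 _ _ _.
Qed.

End Model.

Lemma tree_rigid : rigid tree_adj.
Proof. by move=> B BM v x; exact: model_fixed. Qed.

End Tree.

(** * The induction on cardinals *)

Definition rigid_on (Z : Type) : Prop := exists E : Z -> Z -> Prop,
  [/\ forall x y, E x y -> E y x, forall x, ~ E x x & rigid E].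

Lemma rigid_on_bij V Z (f : V -> Z) : bijective f -> rigid_on V -> rigid_on Z.
Proof.
move=> [g fK gK] [E [Es Ei Er]].
exists (fun x y => E (g x) (g y)).
split=> [x y /Es//|x /Ei//|B [ne cn dj ad] z w Bzw].
rewrite -[w]gK -[z]gK; congr f.
apply: (Er (fun u v => B (f u) (f v))); last by rewrite !gK.
split.
- by move=> v; have [x Bx] := ne (f v); exists (g x); rewrite gK.
- move=> v x y Bx By.
  pose P z := clos_refl_trans V
    (fun a b => [/\ B (f v) (f a), B (f v) (f b) & E a b]) x (g z).
  suff : P (f y) by rewrite /P fK.
  move: (f y) By; apply: (conn_ind (cn (f v)) Bx (P := P)).
    by rewrite /P fK; exact: rt_refl.
  move=> a b Ba Bb Eab; rewrite /P => xa; apply: rt_trans xa _; apply: rt_step.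
  by rewrite !gK.
- by move=> u v x Bu Bv; have := dj _ _ _ Bu Bv; exact: can_inj fK _ _.
- move=> u v Euv; have [|x [y [Bx By Exy]]] := ad (f u) (f v); first by rewrite !fK.
  by exists (g x), (g y); rewrite !gK.
Qed.

Lemma tree_adj_sym X (lab : seq X -> X) (U : X -> Type)
    (R : forall i, U i -> U i -> Prop) D (on : D -> seq X -> Prop) :
  (forall i (u v : U i), R i u v -> R i v u) ->
  forall x y, @tree_adj X lab U R D on x y -> tree_adj R on y x.
Proof.
move=> Rs [s|d|s u] [t|e|t v] //= [e Ruv]; subst t.
by exists erefl; exact: Rs.
Qed.

Lemma tree_adj_irrefl X (lab : seq X -> X) (U : X -> Type)
    (R : forall i, U i -> U i -> Prop) D (on : D -> seq X -> Prop) :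
  (forall i (u : U i), ~ R i u u) -> forall x, ~ @tree_adj X lab U R D on x x.
Proof.
by move=> Ri [s|d|s u] //= [e]; rewrite (Prop_irrelevance e erefl); exact: Ri.
Qed.

Lemma regular_infinite X (lt : X -> X -> Prop) (x0 : X) :
  strict_wo lt -> regular lt -> embeds nat X.
Proof.
move=> lt_wo lt_reg.
have /choice[k kP] x : exists y, lt x y by have [y []] := bound2 lt_reg x x; exists y.
have mono i j : lt (iter i k x0) (iter (i + j.+1) k x0).
  elim: j => [|j IHj]; first by rewrite addn1; exact: kP.
  by rewrite addnS; apply: (wo_trans lt_wo IHj); exact: kP.
exists (fun n => iter n k x0) => n m e.
case: (ltngtP n m) => // nm; exfalso.
  have := mono n (m - n).-1.
  by rewrite prednK ?subn_gt0 // subnKC ?(ltnW nm) // e; exact: wo_irr.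
have := mono m (n - m).-1.
by rewrite prednK ?subn_gt0 // subnKC ?(ltnW nm) // e; exact: wo_irr.
Qed.

Lemma embeds_bool_sum Z : embeds nat Z -> embeds (bool + Z) Z.
Proof.
move=> natZ; apply: (embeds_trans (Y := option (option Z))).
  exists (fun x => match x with
    | inl true => None | inl false => Some None | inr z => Some (Some z) end).
  by move=> [[]|x] [[]|y] // [->].
apply: embeds_trans (embeds_option natZ).
by apply: embeds_option; apply: (embeds_trans natZ); exists Some => x y [].
Qed.

Lemma existT_inj X (U : X -> Type) i : injective (existT U i).
Proof.
move=> u v h.
pose P (x : {i & U i}) := exists e : i = projT1 x, eq_rect i U u _ e = projT2 x.
have : P (existT U i v) by rewrite -h; exists erefl.
by case=> e /= <-; rewrite (Prop_irrelevance e erefl).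
Qed.

(** The tree with its peaks and cells has the cardinality of [Z], and rigidity is carried over by a
    bijection. *)
Lemma rigid_on_tree Z X (lt : X -> X -> Prop) (x0 : X) (U : X -> Type) :
  strict_wo lt -> regular lt -> embeds X Z ->
  (forall i, embeds (U i) Z) -> (forall i, rigid_on (U i)) ->
  (forall j (f : {i & U i} -> U j), inhabited (U j) -> ~ injective f) ->
  embeds Z X \/ embeds Z {i & U i} -> rigid_on Z.
Proof.
move=> lt_wo lt_reg XZ UZ rU U_small big.
have natX := regular_infinite x0 lt_wo lt_reg; have natZ := embeds_trans natX XZ.
pose R i := sval (cid (rU i)).
have RP i : [/\ forall x y, R i x y -> R i y x, forall x, ~ R i x x & rigid (@R i)].
  exact: svalP (cid (rU i)).
have seqX := embeds_seq natX.
have [D [top [on [[o1 o2 o3 o4] [o5 o6 o7]]]]] := branches_exist lt_wo lt_reg seqX.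
(* [x0] only labels the root. *)
pose lab := head x0.
have R_rigid i : rigid (@R i) by case: (RP i).
have T_rigid : rigid (@tree_adj X lab U R D on).
  exact: (tree_rigid lt_wo lt_reg (fun _ _ => erefl) R_rigid U_small o1 o2 o3 o4 o5 o6 o7).
pose V := @vertex X lab U D.
have VZ : embeds V Z.
  apply: (embeds_trans (Y := (X * (bool + {i & U i})))); last first.
    apply: (embeds_trans (Y := Z * Z)); last exact: embeds_square.
    apply: embeds_prod => //; apply: embeds_trans (embeds_bool_sum natZ).
    have [h hI] : embeds {i & U i} Z.
      apply: (embeds_trans (Y := Z * Z)); last exact: embeds_square.
      have [f fI] := XZ.
      pose k i := sval (cid (UZ i)).
      have kI i : injective (k i) := svalP (cid (UZ i)).
      exists (fun p => (f (projT1 p), k (projT1 p) (projT2 p))).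
      by move=> [i u] [j v] /= [/fI ij]; subst j => /kI ->.
    by exists (fun x => match x with inl b => inl b | inr p => inr (h p) end)
      => -[b|p] [b'|p'] // [e]; [rewrite e|rewrite (hI _ _ e)].
  have [c cI] := seqX.
  exists (fun v : V => match v with
    | node s => (c s, inl true)
    | peak d => (top d, inl false)
    | @cell _ _ _ _ s u => (c s, inr (existT U (lab s) u)) end).
  move=> [s|d|s u] [t|e|t v] // [].
  - by move=> /cI ->.
  - by move=> /o1 ->.
  - by move=> /cI st _; subst t => /(@existT_inj X U) ->.
have ZV : embeds Z V.
  case: big => [ZX|ZU].
    by apply: embeds_trans ZX _; exists (fun x => node lab U D [:: x]) => x y [].
  apply: embeds_trans ZU _; exists (fun p => @cell X lab U D [:: projT1 p] (projT2 p)).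
  by move=> [i u] [j v] /= e; have ij : i = j; [case: e|subst j; rewrite (cell_inj e)].
have [f fB] := Cantor_Bernstein_embeds VZ ZV.
apply: rigid_on_bij fB _; exists (@tree_adj X lab U R D on); split=> //.
- by apply: tree_adj_sym => i u v; case: (RP i) => + _ _; apply.
- by apply: tree_adj_irrefl => i u; case: (RP i).
Qed.

Lemma embeds_total X Y : embeds X Y \/ embeds Y X.
Proof.
have [lt ltwo] := wo_exists X.
have [|[a Ya]] := embeds_or_seg Y ltwo; [by left|right].
exact: embeds_trans Ya (embeds_sig _).
Qed.

(** * Cofinality of a well-order *)

Section Cofinality.
Variables (Z : Type) (lt : Z -> Z -> Prop).
Hypotheses (lt_wo : strict_wo lt).

Lemma embeds_closed_seg m : embeds {x | ~ lt m x} (option (seg lt m)).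
Proof.
have /choice[f fP] (y : {x | ~ lt m x}) : exists o : option (seg lt m),
    if o is Some x then sval x = sval y else sval y = m.
  case: (pselect (lt (sval y) m)) => yp.
    by exists (Some (exist (fun x => lt x m) _ yp)).
  exists None; case: (wo_total lt_wo (sval y) m) => // py.
  by case: (svalP y).
exists f => x y e; apply: sval_inj; have := fP x; have := fP y; rewrite e.
by case: (f y) => [z <- <-|-> ->].
Qed.

Lemma initial_no_max : embeds nat Z -> (forall a, ~ embeds Z (seg lt a)) ->
  forall x, exists y, lt x y.
Proof.
move=> natZ ini x; apply: contrapT => /forallNP no.
have Zo : embeds Z (option (seg lt x)).
  apply: embeds_trans (embeds_closed_seg x).
  by exists (fun z => exist (fun y => ~ lt x y) z (no z)) => y z [].
apply: (ini x); apply: (embeds_trans Zo); apply: embeds_option.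
exact: embeds_nat_option (embeds_trans natZ Zo).
Qed.

(** The case of omega_1: a cofinal sequence would make [Z] a countable union of countable segments,
    and a function on a countable segment amounts to a sequence. *)
Lemma regular_of_countable_seg :
  ~ embeds Z nat -> (forall b, embeds (seg lt b) nat) -> regular lt.
Proof.
move=> Zunc segc.
have R2 (g : nat -> Z) : exists c, forall n, lt (g n) c.
  apply: contrapT => /forallNP no; apply: Zunc.
  have /choice[k kP] n : exists k : Z -> nat, forall x y,
      ~ lt (g n) x -> ~ lt (g n) y -> k x = k y -> x = y.
    have [f fI] : embeds {x | ~ lt (g n) x} nat.
      apply: embeds_trans (embeds_closed_seg _) _.
      apply: embeds_trans (embeds_option (embeds_refl nat)).
      have [h hI] := segc (g n).
      exists (fun o => if o is Some x then Some (h x) else None).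
      by move=> [x|] [y|] // [/hI ->].
    have /choice[k kP] x : exists m, forall p : ~ lt (g n) x, m = f (exist _ x p).
      case: (pselect (~ lt (g n) x)) => p; last by exists 0.
      by exists (f (exist _ x p)) => q; rewrite (Prop_irrelevance p q).
    by exists k => x y p q; rewrite (kP _ p) (kP _ q) => /fI[].
  have /choice[m mP] x : exists n, ~ lt (g n) x by apply/existsNP/no.
  apply: embeds_trans (embeds_square (embeds_refl nat)).
  exists (fun x => (m x, k (m x) x)) => x y [exy]; rewrite exy.
  by apply: kP => //; rewrite -exy.
split=> // b f; have [h hI] := segc b.
have /choice[g gP] n : exists y, forall x : seg lt b, h x = n -> y = f (sval x).
  case: (pselect (exists x, h x = n)) => [[x xn]|no].
    by exists (f (sval x)) => y; rewrite -xn => /hI ->.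
  by exists b => x xn; case: no; exists x.
have [c cP] := R2 g; exists c => x xb.
by rewrite -(gP _ (exist (fun x => lt x b) x xb) erefl).
Qed.

(* [X] is the least initial segment with a cofinal map to [Z], or [Z] itself. *)
Lemma cofinality_regular : (forall g : nat -> Z, exists c, forall n, lt (g n) c) ->
  exists (X : Type) (ltX : X -> X -> Prop) (f : X -> Z),
    [/\ strict_wo ltX, regular ltX, embeds X Z & forall z, exists x, lt z (f x)].
Proof.
move=> R2.
pose unb c := exists f : Z -> Z, forall z, exists2 x, lt x c & ~ lt (f x) z.
have nomax x : exists y, lt x y by have [y yP] := R2 (fun=> x); exists y; exact: yP 0.
case: (pselect (exists c, unb c)) => [[c0 c0P]|no]; last first.
  exists Z, lt, id; split=> //; last exact: embeds_refl.
  split=> // b f; apply: contrapT => /forallNP nb; apply: no; exists b, f => z.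
  apply: contrapT => nx; apply: (nb z) => x xb; apply: contrapT => fx.
  by apply: nx; exists x.
have [c [f fP] cmin] := wo_least lt_wo c0P.
pose X := seg lt c; pose ltX (u v : X) := lt (sval u) (sval v).
(* By minimality of [c], [f] is bounded on each shorter segment. *)
have /choice[F FP] (y : X) : exists e, forall x, ~ lt (sval y) x -> lt (f x) e.
  have [e eP] : exists e, forall x, lt x (sval y) -> lt (f x) e.
    apply: contrapT => /forallNP nb; apply: (cmin (sval y) _ (svalP y)).
    exists f => z; apply: contrapT => nx; apply: (nb z) => x xb.
    by apply: contrapT => fx; apply: nx; exists x.
  have [e' e'P] := R2 (fun n => if n is 0 then e else f (sval y)).
  exists e' => x yx; case: (wo_total lt_wo x (sval y)) => // [xy|->].
    exact: (wo_trans lt_wo (eP x xy) (e'P 0)).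
  exact: (e'P 1).
exists X, ltX, (fun x => f (sval x)); split.
- exact: seg_wo.
- split=> [b g|g].
    apply: contrapT => /forallNP nb; apply: (cmin (sval b) _ (svalP b)).
    (* [Phi] extends the composite of [F] and [g] to [Z]; were [g] unbounded below [b], it would
       contradict the minimality of [c]. *)
    have /choice[Phi PhiP] x : exists y, forall p : lt x c, y = F (g (exist _ x p)).
      case: (pselect (lt x c)) => p; last by exists x.
      by exists (F (g (exist _ x p))) => q; rewrite (Prop_irrelevance p q).
    exists Phi => z; have [x xc fx] := fP z.
    have /existsNP[[y yc] /not_implyP[yb gy]] := nb (exist _ x xc).
    exists y => //; rewrite (PhiP _ yc) => Fz; apply: fx.
    exact: (wo_trans lt_wo (FP _ _ gy) Fz).
  apply: contrapT => /forallNP nb; have [z zP] := R2 (fun n => F (g n)).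
  have [x xc fx] := fP z; have /existsNP[n gn] := nb (exist _ x xc).
  apply: fx; exact: (wo_trans lt_wo (FP _ _ gn) (zP n)).
- exact: embeds_sig.
- move=> z; have [z' zz'] := nomax z; have [x xc fx] := fP z'.
  by exists (exist _ x xc); exact: wo_lt_nlt zz' fx.
Qed.

End Cofinality.

Lemma rigid_on_empty Z : ~ inhabited Z -> rigid_on Z.
Proof.
by move=> Z0; exists (fun _ _ => False); split=> [//|x []|B _ v]; case: Z0.
Qed.

Theorem rigid_on_uncountable Z : ~ embeds Z nat -> rigid_on Z.
Proof.
elim/card_ind: Z => Z IH Zunc.
have natZ : embeds nat Z by case: (embeds_total nat Z) => // h; case: (Zunc h).
have [lt [lt_wo ini]] := initial_wo Z.
have nomax := initial_no_max lt_wo natZ ini.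
have [z0 _] : exists z0 : Z, True by have [f _] := natZ; exists (f 0).
(* If all proper segments are countable, [Z] is omega_1 and nothing is attached to the nodes. *)
case: (pselect (exists b, ~ embeds (seg lt b) nat)) => [[b0 b0P]|allc]; last first.
  have segc b : embeds (seg lt b) nat by apply: contrapT => nb; apply: allc; exists b.
  apply: (rigid_on_tree z0 lt_wo (regular_of_countable_seg lt_wo Zunc segc)
     (embeds_refl Z) (U := fun=> Empty_set)).
  - by move=> _; exists (fun x : Empty_set => match x with end) => -[].
  - by move=> _; apply: rigid_on_empty => -[[]].
  - by move=> _ f [[]].
  - by left; exact: embeds_refl.
suff [X [ltX [f [ltX_wo ltX_reg XZ f_unb]]]] :
    exists (X : Type) (ltX : X -> X -> Prop) (f : X -> Z),
      [/\ strict_wo ltX, regular ltX, embeds X Z & forall z, exists x, lt z (f x)].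
  have [x0 _] := f_unb z0.
  (* The segment below [f i] if it is uncountable, so that induction applies, and empty
     otherwise. *)
  pose U i := {z | lt z (f i) /\ ~ embeds (seg lt (f i)) nat}.
  have U_seg i : embeds (U i) (seg lt (f i)).
    exists (fun u : U i => exist (fun z => lt z (f i)) (sval u) (svalP u).1).
    by move=> u v [/sval_inj].
  have Z_U : embeds Z {i & U i}.
    have /choice[i iP] z : exists i, lt z (f i) /\ ~ embeds (seg lt (f i)) nat.
      have segS a b : lt a b \/ a = b -> embeds (seg lt a) (seg lt b).
        move=> ab; have sub x : lt x a -> lt x b.
          by case: ab => [ab|<-] // xa; exact: (wo_trans lt_wo) ab.
        exists (fun x : seg lt a => exist (fun y => lt y b) (sval x) (sub _ (svalP x))).
        by move=> x y [/sval_inj].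
      case: (wo_total lt_wo z b0) => zb.
      + have [i bi] := f_unb b0; exists i; split; first exact: (wo_trans lt_wo) bi.
        by move=> sc; apply: b0P; apply: embeds_trans sc; apply: segS; left.
      + have [i bi] := f_unb z; exists i; split=> // sc; apply: b0P; apply: embeds_trans sc.
        by apply: segS; left; rewrite -zb.
      + have [i bi] := f_unb z; exists i; split=> // sc; apply: b0P; apply: embeds_trans sc.
        by apply: segS; left; exact: (wo_trans lt_wo) bi.
    exists (fun z => existT U (i z) (exist _ z (iP z))) => z w e.
    exact: (congr1 (fun p : {i & U i} => sval (projT2 p)) e).
  apply: (rigid_on_tree x0 ltX_wo ltX_reg XZ (U := U)).
  - by move=> i; exact: embeds_sig.
  - move=> i; case: (pselect (embeds (seg lt (f i)) nat)) => segc.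
      by apply: rigid_on_empty => -[[z [_]]].
    apply: IH => [ZU|Uc]; first exact: (ini _ (embeds_trans ZU (U_seg i))).
    apply: (segc _); apply: embeds_trans Uc.
    exists (fun u : seg lt (f i) =>
      exist (fun z => lt z (f i) /\ _) (sval u) (conj (svalP u) segc)).
    by move=> u v [/sval_inj].
  - move=> j g _ gI; apply: (ini (f j)); apply: embeds_trans Z_U _.
    by apply: embeds_trans (U_seg j); exists g.
  - by right.
case: (pselect (forall g : nat -> Z, exists c, forall n, lt (g n) c)) => [R2|].
  exact: cofinality_regular lt_wo R2.
move=> /existsNP[g /forallNP gP].
(* [g] is cofinal in [Z], and the segment of [c] is omega_1. The map [f] follows [g] on a copy of
   [nat] in it, with default value [z0]. *)
have [c cP cmin] := wo_least lt_wo (P := fun b => ~ embeds (seg lt b) nat) b0P.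
have c_wo := seg_wo c lt_wo.
have [h hI] : embeds nat (seg lt c).
  by case: (embeds_total nat (seg lt c)) => // h; case: (cP h).
have /choice[f fP] (x : seg lt c) : exists z, forall n, x = h n -> z = g n.
  case: (pselect (exists n, x = h n)) => [[n xn]|no].
    by exists (g n) => m; rewrite xn => /hI ->.
  by exists z0 => n xn; case: no; exists n.
exists (seg lt c), (fun u v => lt (sval u) (sval v)), f; split=> //.
- apply: (regular_of_countable_seg c_wo cP) => b.
  apply: (embeds_trans (Y := seg lt (sval b))); last first.
    by apply: contrapT => nb; exact: (cmin _ nb (svalP b)).
  exists (fun x : seg (fun u v : seg lt c => lt (sval u) (sval v)) b =>
    exist (fun y => lt y (sval b)) (sval (sval x)) (svalP x)).
  by move=> x y [/sval_inj/sval_inj].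
- exact: embeds_sig.
- move=> z; have [z' zz'] := nomax z; have /existsNP[n gn] := gP z'.
  by exists (h n); rewrite (fP _ n erefl); exact: wo_lt_nlt zz' gn.
Qed.

Unset Implicit Arguments.

Theorem theorem1p12 (K : Type) (K_uncountable : ~ countable [set: K]) :
  exists (T : Type) (G : graph T),
    (vertices G #= [set: K]) /\ ~ proper_minor G G.
Proof.
have [E [Es Ei Er]] : rigid_on K.
  by apply: rigid_on_uncountable => /embedsP.
have Ev x y : E x y -> [set: K] x /\ [set: K] y by [].
exists K, (Graph Ev Es Ei); split; first exact: card_eqxx.
move=> [G' [[sub nsub] [B [BP Bdisj Badj]]]]; apply: nsub.
(* A model in the subgraph [G'] is also one in the whole graph. By rigidity its branch sets are
   singletons, so [G'] has all vertices and edges. *)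
have BE : model E B.
  split.
  - by move=> v; have [] := BP v I.
  - move=> v x y Bx By; have [Bsub _ cn] := BP v I.
    have := cn x y (conj (Bsub _ Bx) Bx) (conj (Bsub _ By) By).
    elim=> {x y Bx By} [x y [Bx By /sub.2 Exy]|x|x y z _ xy _ yz].
    + exact: rt_step.
    + exact: rt_refl.
    + exact: rt_trans yz.
  - by move=> u v x Bu Bv; apply: Bdisj => //; exists x.
  - by move=> u v /Badj[x [y [Bx By /sub.2 Exy]]]; exists x, y.
have Bv v : B v v by have [_ [x Bx] _] := BP v I; rewrite -{2}(Er B BE v x Bx).
split=> [v _|x y Exy]; first by have [+ _ _] := BP v I; apply; exact: Bv.
have [x' [y' [/(Er B BE) -> /(Er B BE) ->]]] := Badj _ _ Exy.
by [].
Qed.
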